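(* Let $\mathcal{G}$ be a stable class of bipartite graphs that satisfies at least one of the following conditions: (1) there exist constants $s,t$ such that no graph in $\mathcal{G}$ contains $S_{s,t}$ or $\overline{S_{s,t}}^{\,b}$ as an induced subgraph; or (2) there exists a constant $t$ such that for every even $t'\ge t$, no graph in $\mathcal{G}$ contains $C_{t'}$ or $\overline{C_{t'}}^{\,b}$ as an induced subgraph. Then $\mathsf{D}^{\mathrm{Eq}}(\mathcal{G})=O(1)$.
   Context: A class of bipartite graphs is a set of bipartite graphs (each with a fixed bipartition) closed under isomorphism. For a bipartite graph $H=(X,Y,E)$, its bipartite complement $\overline{H}^{\,b}$ is $(X,Y,(X\times Y)\setminus E)$; for the connected bipartite graphs $S_{s,t}$ and $C_{t'}$ (even $t'$) the bipartition is the unique one. $S_{s,t}$ is the subdivided star: the star with $s$ leaves in which each edge is subdivided $t-1$ times (i.e., $s$ paths of $t$ edges sharing one endpoint). $C_{t'}$ is the cycle on $t'$ vertices. Chain-index $\mathrm{ch}(G)$: the largest $k$ such that there are $2k$ distinct vertices $a_1,\dots,a_k,b_1,\dots,b_k$ with, for all $i<j$, $a_ib_j$ an edge and $b_ia_j$ a non-edge. A class is stable if $\mathrm{ch}$ is bounded by a constant over the class. $\mathsf{D}^{\mathrm{Eq}}$: for $M\in\{\pm1\}^{X\times Y}$, $\mathsf{D}^{\mathrm{Eq}}(M)$ is the minimum depth of a rooted binary tree in which each internal node $v$ carries functions $\alpha_v:X\to\mathbb{N}$, $\beta_v:Y\to\mathbb{N}$ and each leaf carries a value in $\{\pm1\}$,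 such that for every $(x,y)$, starting at the root and moving to the right child if $\alpha_v(x)=\beta_v(y)$ and to the left child otherwise, the leaf reached has value $M(x,y)$ (a deterministic protocol with Equality oracle queries). For a class $\mathcal{G}$ of bipartite graphs, $\mathsf{D}^{\mathrm{Eq}}(\mathcal{G})=O(1)$ means there is a constant $c$ with $\mathsf{D}^{\mathrm{Eq}}(\mathrm{Adj}_G)\le c$ for all $G\in\mathcal{G}$, where $\mathrm{Adj}_G\in\{\pm1\}^{X\times Y}$ is the bipartite adjacency matrix ($1$ iff $xy$ is an edge). *)

(* Defs.v *)
From mathcomp Require Import all_boot.
From mathcomp.classical Require Import boolp.

Set Implicit Arguments.
Unset Strict Implicit.
Unset Printing Implicit Defensive.

(** * Bipartite graphs *)

Record bigraph : Type := Bigraph {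
  bX : finType;
  bY : finType;
  bedge : bX -> bY -> bool }.

Definition bicompl (G : bigraph) : bigraph :=
  Bigraph (fun (x : bX G) (y : bY G) => ~~ bedge x y).

(* Isomorphisms respect the fixed ordered bipartition. *)
Definition biso (G H : bigraph) : Prop :=
  exists (f : bX G -> bX H) (g : bY G -> bY H),
    [/\ bijective f, bijective g & forall x y, bedge (f x) (g y) = bedge x y].

Definition iso_closed (C : bigraph -> Prop) : Prop :=
  forall G H : bigraph, biso G H -> C G -> C H.

(* The underlying (uncoloured) graph lives on the disjoint union of the parts. *)
Notation vertex G := (bX G + bY G)%type.

Definition adj (G : bigraph) : rel (vertex G) := fun u v =>
  match u, v with
  | inl x, inr y => bedge x y
  | inr y, inl x => bedge x y
  | _, _ => false
  end.

(* Containment is between the underlying graphs: an embedding need not send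
   the X-side of H to the X-side of G. *)
Definition contains_induced (G H : bigraph) : Prop :=
  exists f : vertex H -> vertex G,
    injective f /\ forall u v, adj (f u) (f v) = adj u v.

(** * The graphs S_{s,t} and C_n *)

(* The graph with edge relation e, bipartitioned by the proper 2-colouring col
   into X = col^-1(false) and Y = col^-1(true). *)
Definition bigraph_of (V : finType) (e : rel V) (col : pred V) : bigraph :=
  @Bigraph {v : V | ~~ col v} {v : V | col v} (fun x y => e (val x) (val y)).

(* None is the centre, and Some (i, j) is the vertex at distance j + 1 from the
   centre on the i-th path; the colour is the parity of the distance.  As in
   "each edge is subdivided t - 1 times", this is meant for 0 < t. *)
Section SubdividedStar.
Variables s t : nat.

Definition star_edge : rel (option ('I_s * 'I_t)) := fun u v =>
  match u, v with
  | None, None => false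
  | None, Some (_, j) | Some (_, j), None => j == 0 :> nat
  | Some (i, j), Some (i', j') =>
      (i == i') && ((j' == j.+1 :> nat) || (j == j'.+1 :> nat))
  end.

Definition star_col : pred (option ('I_s * 'I_t)) := fun u =>
  if u is Some (_, j) then odd j.+1 else false.

Lemma star_col_proper u v : star_edge u v -> star_col u != star_col v.
Proof.
case: u v => [[i j]|] [[i' j']|] //=; [|by move/eqP->|by move/eqP->].
by case/andP=> _ /orP[] /eqP-> /=; case: odd.
Qed.

Definition subdivided_star : bigraph := bigraph_of star_edge star_col.
End SubdividedStar.

(* Meant for even n >= 4, where it is the n-cycle with its unique bipartition
   (for odd n the colouring by parity is not proper). *)
Section Cycle.
Variable n : nat.

Definition cycle_edge : rel 'I_n := fun i j =>
  (j == i.+1 %% n :> nat) || (i == j.+1 %% n :> nat).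

Definition cycle_col : pred 'I_n := fun i => odd i.

Lemma cycle_col_proper i j :
  ~~ odd n -> cycle_edge i j -> cycle_col i != cycle_col j.
Proof.
rewrite /cycle_col => n_even.
have oddS (k : 'I_n) : odd (k.+1 %% n) = ~~ odd k.
  have := ltn_ord k; rewrite leq_eqVlt => /orP[/eqP kn|lt_kn].
    by rewrite kn modnn -[~~ odd k]/(odd k.+1) kn (negPf n_even).
  by rewrite modn_small.
by case/orP=> /eqP->; rewrite oddS; case: odd.
Qed.

Definition even_cycle : bigraph := bigraph_of cycle_edge cycle_col.
End Cycle.

(** * Chain-index and stability *)

Definition has_chain (G : bigraph) (k : nat) : bool :=
  [exists a : {ffun 'I_k -> vertex G}, exists b : {ffun 'I_k -> vertex G},
    [&& injectiveb a, injectiveb b, [forall i, forall j, a i != b j]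
      & [forall i : 'I_k, forall j : 'I_k,
          (i < j) ==> adj (a i) (b j) && ~~ adj (b i) (a j)]]].

(* The range of the maximum is harmless: see has_chain_leq. *)
Definition chain_index (G : bigraph) : nat :=
  \max_(k < #|{: vertex G}|.+1 | has_chain G k) k.

Lemma has_chain_leq (G : bigraph) k : has_chain G k -> k <= #|{: vertex G}|.
Proof.
case/existsP=> a /existsP[b /and4P[/injectiveP a_inj _ _ _]].
by rewrite -[k in k <= _]card_ord (leq_card a a_inj).
Qed.

Lemma has_chain0 (G : bigraph) : has_chain G 0.
Proof.
have f : {ffun 'I_0 -> vertex G} by apply: finfun => -[].
apply/existsP; exists f; apply/existsP; exists f; apply/and4P; split.
- by apply/injectiveP=> -[].
- by apply/injectiveP=> -[].
- by apply/forallP=> -[].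
- by apply/forallP=> -[].
Qed.

Lemma chain_indexP (G : bigraph) :
  has_chain G (chain_index G) /\
  forall k, has_chain G k -> k <= chain_index G.
Proof.
split=> [|k Gk].
  rewrite /chain_index; apply: (big_ind (has_chain G)) => // [|m n Gm Gn].
    exact: has_chain0.
  by rewrite /maxn; case: ifP.
have lt_k : k < #|{: vertex G}|.+1 by rewrite ltnS has_chain_leq.
exact: (leq_bigmax_cond (Ordinal lt_k)).
Qed.

Definition stable (C : bigraph -> Prop) : Prop :=
  exists k, forall G, C G -> chain_index G <= k.

(** * Deterministic protocols with equality queries *)

(* The values +1 and -1 are encoded as true and false. *)
Section EqProtocol.
Variables X Y : Type.

Inductive eq_protocol : Type :=
| Leaf (value : bool)
| Node (alpha : X -> nat) (beta : Y -> nat) (left right : eq_protocol).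

Fixpoint depth (T : eq_protocol) : nat :=
  if T is Node _ _ l r then (maxn (depth l) (depth r)).+1 else 0.

Fixpoint run (T : eq_protocol) (x : X) (y : Y) : bool :=
  match T with
  | Leaf v => v
  | Node alpha beta l r => if alpha x == beta y then run r x y else run l x y
  end.

Definition computes (T : eq_protocol) (M : X -> Y -> bool) : Prop :=
  forall x y, run T x y = M x y.
End EqProtocol.

Definition DEq_depth (X Y : Type) (M : X -> Y -> bool) (d : nat) : Prop :=
  exists T : eq_protocol X Y, depth T = d /\ computes T M.

Lemma DEq_depth_ex (X Y : finType) (M : X -> Y -> bool) :
  exists d, `[< DEq_depth M d >].
Proof.
suff [T TP] : exists T : eq_protocol X Y, computes T M.
  by exists (depth T); apply/asboolP; exists T.
suff [T TP] : exists T : eq_protocol X Y,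
    forall x y, run T x y = (x \in enum X) && M x y.
  by exists T => x y; rewrite TP mem_enum.
elim: (enum X) => [|x0 s [T TP]]; first by exists (Leaf _ _ false).
exists (Node (fun x => x == x0 : nat) (fun y => if M x0 y then 1 else 2)
             T (Leaf _ _ true)) => x y /=.
rewrite TP inE; case: (x =P x0) => [->|_] /=; last by case: (M x0 y).
by case: (M x0 y) => //=; rewrite andbF.
Qed.

Definition DEq (X Y : finType) (M : X -> Y -> bool) : nat :=
  ex_minn (DEq_depth_ex M).

(* In the above encoding the matrix Adj_G is bedge itself. *)
Definition DEq_bounded (C : bigraph -> Prop) : Prop :=
  exists c, forall G : bigraph, C G -> DEq (@bedge G) <= c.

(** * Forbidden induced subgraphs *)

Definition free_of (C : bigraph -> Prop) (H : bigraph) : Prop :=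
  forall G, C G -> ~ contains_induced G H.

(* Main.v *)
Require Import Defs.
From mathcomp Require Import all_boot zify.
From mathcomp.classical Require Import boolp.

(* Root a Gyarfas decomposition in every component: a node is a pair (u, K) of
   a vertex u and a connected set K, its bag is N(u) :&: K, and every component
   K' of the rest of K gives a child (u', K'), where u' lies in the bag and has a
   neighbour in K'.  Adjacent vertices lie in bags one of which is an ancestor of
   the other, and the chosen vertices u on the way down to y form an induced path
   ending at y.  If y had neighbours x_i in many ancestor bags, then Ramsey's
   theorem and stability would give many x_i whose bags are far apart on the path
   and such that x_i has no neighbour on the path just above the bag of a later
   x_j: hence an induced subdivided star centred at y, and a long induced cycle
   formed by some x_i and a segment of the path.  So each vertex can list its few
   relevant ancestor bags, and equality queries find the bag of the other vertex.

   Inside a node with bag A and remaining set D, u is complete to A and the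
   vertex chosen one level higher is anticomplete to D, so every half graph
   between A and D extends by one more pair: induct on the length of the longest
   half graph.  A root has no vertex above it; there the pair (A, D) is decomposed
   again in the bipartite complement with roots in A, and the first root u
   plays the role of the missing vertex. *)

Set Implicit Arguments.
Unset Strict Implicit.
Unset Printing Implicit Defensive.

(** * Protocols under a promise *)

Definition solvable (X Y : Type) (c : nat) (P : X -> Y -> Prop)
    (M : X -> Y -> bool) : Prop :=
  exists2 T : eq_protocol X Y, depth T <= c &
    forall x y, P x y -> run T x y = M x y.

Lemma solvable_sub (X Y : Type) c c' (P P' : X -> Y -> Prop) M M' :
    c <= c' -> (forall x y, P' x y -> P x y /\ M x y = M' x y) ->
  solvable c P M -> solvable c' P' M'.
Proof.
move=> cc' PP' [T Tc TP]; exists T; first exact: leq_trans cc'.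
by move=> x y /PP' [Pxy <-]; apply: TP.
Qed.

Lemma solvable_const (X Y : Type) v (P : X -> Y -> Prop) M :
  (forall x y, P x y -> M x y = v) -> solvable 0 P M.
Proof. by move=> PM; exists (Leaf _ _ v) => // x y /PM. Qed.

Lemma solvable_node (X Y : Type) c (alpha : X -> nat) (beta : Y -> nat)
    (P : X -> Y -> Prop) M :
    solvable c (fun x y => P x y /\ alpha x <> beta y) M ->
    solvable c (fun x y => P x y /\ alpha x = beta y) M ->
  solvable c.+1 P M.
Proof.
case=> [L Lc LP] [R Rc RP]; exists (Node alpha beta L R) => /=.
  by rewrite ltnS geq_max Lc Rc.
by move=> x y Pxy; case: eqP => ab; [apply: RP | apply: LP].
Qed.

Lemma solvable_left (X Y : Type) (g : X -> bool) (P : X -> Y -> Prop) M :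
  (forall x y, P x y -> M x y = g x) -> solvable 1 P M.
Proof.
move=> Pg; exists (Node g (fun _ => 1) (Leaf _ _ false) (Leaf _ _ true)) => //.
by move=> x y /Pg-> /=; case: (g x).
Qed.

Lemma solvable_negb (X Y : Type) c (P : X -> Y -> Prop) M :
  solvable c P M -> solvable c P (fun x y => ~~ M x y).
Proof.
case=> T Tc TP.
suff [U Uc UP] : exists2 U : eq_protocol X Y,
    depth U = depth T & forall x y, run U x y = ~~ run T x y.
  by exists U => [|x y /TP <-]; rewrite ?Uc.
elim: T {Tc TP} => [v|al be L [L' Ld LP] R [R' Rd RP]].
  by exists (Leaf _ _ (~~ v)).
exists (Node al be L' R') => [|x y] /=; first by rewrite Ld Rd.
by case: eqP.
Qed.

Lemma solvable_swap (X Y : Type) c (P : X -> Y -> Prop) M :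
  solvable c P M -> solvable c (fun y x => P x y) (fun y x => M x y).
Proof.
case=> T Tc TP.
suff [U Uc UP] : exists2 U : eq_protocol Y X,
    depth U = depth T & forall x y, run U x y = run T y x.
  by exists U => [|x y /TP <-]; rewrite ?Uc.
elim: T {Tc TP} => [v|al be L [L' Ld LP] R [R' Rd RP]].
  by exists (Leaf _ _ v).
exists (Node be al L' R') => [|x y] /=; first by rewrite Ld Rd.
by rewrite eq_sym; case: eqP.
Qed.

Lemma solvable_comp (X Y X' Y' : Type) (f : X' -> X) (g : Y' -> Y) c
    (P : X -> Y -> Prop) M : solvable c P M ->
  solvable c (fun x y => P (f x) (g y)) (fun x y => M (f x) (g y)).
Proof.
case=> T Tc TP.
suff [U Uc UP] : exists2 U : eq_protocol X' Y',
    depth U = depth T & forall x y, run U x y = run T (f x) (g y).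
  by exists U => [|x y /TP <-]; rewrite ?Uc.
elim: T {Tc TP} => [v|al be L [L' Ld LP] R [R' Rd RP]].
  by exists (Leaf _ _ v).
exists (Node (al \o f) (be \o g) L' R') => [|x y] /=; first by rewrite Ld Rd.
by case: eqP.
Qed.

(* Each T i is read as a complete binary tree of depth c; only the leaf values
   then still depend on i, and one more query reveals them. *)
Lemma run_family (X Y I : Type) (la : X -> I) (lb : Y -> I) c
    (T : I -> eq_protocol X Y) :
    (forall i, depth (T i) <= c) ->
  exists2 U : eq_protocol X Y, depth U <= c.+1 &
    forall x y, la x = lb y -> run U x y = run (T (la x)) x y.
Proof.
elim: c T => [|c IHc] T Tc.
  exists (Node (fun x => if T (la x) is Leaf v then v : nat else 0) (fun _ => 1)
               (Leaf _ _ false) (Leaf _ _ true)) => //= x y _.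
  by move: (Tc (la x)); case: (T (la x)) => //= -[].
pose l i := if T i is Node _ _ L _ then L else T i.
pose r i := if T i is Node _ _ _ R then R else T i.
have [|L Lc LP] := IHc l.
  by move=> i; move: (Tc i); rewrite /l; case: (T i) => //= *; lia.
have [|R Rc RP] := IHc r.
  by move=> i; move: (Tc i); rewrite /r; case: (T i) => //= *; lia.
exists (Node (fun x => if T (la x) is Node al _ _ _ then al x else 0)
             (fun y => if T (lb y) is Node _ be _ _ then be y else 0) L R).
  by rewrite /= ltnS geq_max Lc Rc.
move=> x y xy /=; rewrite (RP _ _ xy) (LP _ _ xy) -xy /l /r.
by case: (T (la x)) => //= v; case: ifP.
Qed.

Lemma solvable_label (X Y I : Type) (la : X -> I) (lb : Y -> I) c
    (P : X -> Y -> Prop) M :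
    (forall i, solvable c (fun x y => [/\ P x y, la x = i & lb y = i]) M) ->
  solvable c.+1 (fun x y => P x y /\ la x = lb y) M.
Proof.
move=> H.
have [T TP] := choice (fun i => let: ex_intro2 T Tc TM := H i in
  ex_intro (fun T => depth T <= c /\ forall x y,
    [/\ P x y, la x = i & lb y = i] -> run T x y = M x y) T (conj Tc TM)).
have [U Uc UP] := run_family la lb (fun i => proj1 (TP i)).
exists U => // x y [Pxy xy]; rewrite UP //; apply: (proj2 (TP _)).
by split.
Qed.

(** The label of [x] is compared with the candidates of [y] one by one. A hit makes the label common
    to both sides, at the price of [solvable_label]; after [d] misses [c0] takes over. *)
Lemma solvable_list (X Y : Type) (I : countType) (la : X -> I)
    (L : Y -> seq I) d c c0 (P : X -> Y -> Prop) M :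
    (forall x y, P x y -> size (L y) <= d) ->
    (forall i, solvable c (fun x y => [/\ P x y, la x = i & i \in L y]) M) ->
    solvable c0 (fun x y => P x y /\ la x \notin L y) M ->
  solvable (d + maxn c0 c.+1) P M.
Proof.
elim: d L P => [|d IHd] L P Ld Hc H0.
  apply: solvable_sub H0; first by rewrite add0n leq_maxl.
  move=> x y Pxy; split=> //; split=> //.
  by have := Ld _ _ Pxy; rewrite leqn0 => /nilP->.
(* Codes are shifted by one, so that 0, standing for the empty list, matches no label. *)
apply: (@solvable_node _ _ _ (fun x => (pickle (la x)).+1)
  (fun y => if L y is i :: _ then (pickle i).+1 else 0)).
  apply: (IHd (fun y => behead (L y))).
  - by move=> x y [/Ld]; rewrite size_behead; lia.
  - move=> i; apply: solvable_sub (Hc i) => // x y [[Pxy _] -> iL].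
    by split=> //; split=> //; exact: mem_behead iL.
  apply: solvable_sub H0 => // x y [[Pxy neq] nL]; do 2!split=> //.
  case: (L y) neq nL => //= i s neq; rewrite inE => /negPf->; rewrite orbF.
  by apply: contra_notN neq => /eqP->.
have H : solvable c.+1 (fun x y =>
    (P x y /\ Some (la x) = ohead (L y)) /\ Some (la x) = ohead (L y)) M.
  apply: (solvable_label (la := fun x => Some (la x))
                         (lb := fun y => ohead (L y))) => -[i|]; last first.
    by exists (Leaf _ _ true) => // x y [].
  apply: solvable_sub (Hc i) => // x y [[Pxy _] [<-]].
  by case: (L y) => //= j s [<-]; rewrite mem_head.
apply: solvable_sub H => [|x y [Pxy]].
  exact: leq_trans (leq_maxr c0 _) (leq_addl _ _).
by case: (L y) => //= i s [] /(pcan_inj pickleK) ->.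
Qed.

(** * Ramsey's theorem for pairs *)

(** The first term [a] splits the rest by [r a], as in the usual recursion on [(k, m)]. *)
Lemma ramsey k m : exists N, forall (T : eqType) (r : rel T) (s : seq T),
  N <= size s ->
  (exists s', [/\ subseq s' s, size s' = k & pairwise r s']) \/
  (exists s', [/\ subseq s' s, size s' = m & pairwise (fun x y => ~~ r x y) s']).
Proof.
elim: k m => [|k IHk] m.
  by exists 0 => T r s _; left; exists [::]; rewrite sub0seq.
elim: m => [|m [N2 HN2]].
  by exists 0 => T r s _; right; exists [::]; rewrite sub0seq.
have [N1 HN1] := IHk m.+1.
exists (N1 + N2).+1 => T r [//|a s]; rewrite /= ltnS => Ns.
have cs := count_predC (r a) s.
have [le1|lt1] := leqP N1 (count (r a) s).
  rewrite -size_filter in le1; case: (HN1 T r _ le1) => -[s' [ss sz pw]].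
    left; exists (a :: s'); split=> /=.
    - by rewrite eqxx; exact: subseq_trans ss (filter_subseq _ _).
    - by rewrite sz.
    rewrite pw andbT; apply/allP => x /(mem_subseq ss).
    by rewrite mem_filter => /andP[].
  right; exists s'; split=> //.
  exact: subseq_trans ss (subseq_trans (filter_subseq _ _) (subseq_cons _ _)).
have le2 : N2 <= size (filter (predC (r a)) s) by rewrite size_filter; lia.
case: (HN2 T r _ le2) => -[s' [ss sz pw]].
  left; exists s'; split=> //.
  exact: subseq_trans ss (subseq_trans (filter_subseq _ _) (subseq_cons _ _)).
right; exists (a :: s'); split=> /=.
- by rewrite eqxx; exact: subseq_trans ss (filter_subseq _ _).
- by rewrite sz.
rewrite pw andbT; apply/allP => x /(mem_subseq ss).
by rewrite mem_filter => /andP[].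
Qed.

Lemma ramsey_avoid k m t : exists N,
  forall (T : eqType) (r : nat -> rel T) (s : seq T),
    (forall p s', p < t -> subseq s' s -> pairwise (r p) s' -> size s' < k) ->
    N <= size s ->
  exists s', [/\ subseq s' s, size s' = m &
    forall p, p < t -> pairwise (fun x y => ~~ r p x y) s'].
Proof.
elim: t => [|t [N1 HN1]].
  exists m => T r s _ ms; exists (take m s).
  by rewrite take_subseq size_takel.
have [N HN] := ramsey k N1.
exists N => T r s rk Ns; case: (HN T (r t) s Ns) => -[s1 [ss1 sz1 pw1]].
  by have := rk t s1 (ltnSn t) ss1 pw1; rewrite sz1 ltnn.
have [||s2 [ss2 sz2 pw2]] := HN1 T r s1; last 1 first.
- exists s2; split=> // [|p]; first exact: subseq_trans ss1.
  rewrite ltnS leq_eqVlt => /orP[/eqP->|]; last exact: pw2.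
  exact: subseq_pairwise ss2 pw1.
- move=> p s' pt ss'; apply: rk; first by lia.
  exact: subseq_trans ss1.
by rewrite sz1.
Qed.

(** * Half graphs and induced paths *)

Section Graphs.
Variables (V : finType) (side : V -> bool).
Implicit Types (e : rel V) (W A D S K : {set V}) (u : nat -> V).

Definition bipartite e := forall x y, e x y -> side y = ~~ side x.

Definition compl_rel e : rel V := fun x y => (side x != side y) && ~~ e x y.

Lemma compl_rel_sym e : symmetric e -> symmetric (compl_rel e).
Proof. by move=> es x y; rewrite /compl_rel es eq_sym. Qed.

Lemma compl_rel_bip e : bipartite (compl_rel e).
Proof. by move=> x y /andP[]; case: (side x) (side y) => -[]. Qed.

(* The diagonal pairs (a i, b i) are unconstrained, which makes the notion
   invariant under swapping the sides and under bipartite complement. *)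
Definition chain e W sd k := exists a b : nat -> V,
  (forall i, i < k -> [/\ a i \in W, b i \in W, side (a i) = sd
     & side (b i) = ~~ sd]) /\
  (forall i j, i < j < k -> e (a i) (b j) /\ ~~ e (a j) (b i)).

(** Exchange the two rows and reverse the order of the indices. *)
Lemma chainN e W sd k : symmetric e -> chain e W sd k -> chain e W (~~ sd) k.
Proof.
move=> es [a [b [Hs He]]].
exists (fun i => b (k.-1 - i)), (fun i => a (k.-1 - i)); split.
  by move=> i ik; have [|? ? ? ?] := Hs (k.-1 - i); [lia | rewrite negbK].
move=> i j ijk; have [|e1 e2] := He (k.-1 - j) (k.-1 - i); first lia.
by rewrite es e1 es.
Qed.

(** Complementation swaps the edges above the diagonal with the non-edges below it; exchanging the
    two rows restores the pattern. *)
Lemma chain_of_compl e W sd k :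
  symmetric e -> chain (compl_rel e) W sd k -> chain e W (~~ sd) k.
Proof.
move=> es [a [b [Hs He]]]; exists b, a; split.
  by move=> i /Hs []; rewrite negbK.
move=> i j ijk; have [/andP[_ e1] e2] := He i j ijk; split; last by rewrite es.
move: e2; rewrite /compl_rel es; case: (Hs i) => [|_ _ _ ->]; first lia.
by case: (Hs j) => [|_ _ -> _]; [lia | case: sd {Hs} => /=; rewrite negbK].
Qed.

Lemma chain_to_compl e W sd k :
  symmetric e -> chain e W sd k -> chain (compl_rel e) W (~~ sd) k.
Proof.
move=> es [a [b [Hs He]]]; exists b, a; split.
  by move=> i /Hs []; rewrite negbK.
move=> i j ijk; have [e1 e2] := He i j ijk; rewrite /compl_rel ![e (b _) _]es e1 e2 andbF.
have [|_ _ _ ->] := Hs i; first lia.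
by have [|_ _ -> _] := Hs j; [lia | case: sd {Hs}].
Qed.

(** The pair [(p, q)] goes in front: [p] sees the whole row in [A], and [q] misses the whole row in
    [D]. *)
Lemma chain_extend e W A D p q sd k :
    symmetric e -> p \in W -> q \in W -> A \subset W -> D \subset W ->
    (forall x, x \in A -> e p x) -> (forall y, y \in D -> ~~ e q y) ->
    side q = ~~ side p ->
    (forall x, x \in A -> side x = ~~ side p) ->
    (forall y, y \in D -> side y = side p) ->
  chain e (A :|: D) sd k -> exists sd', chain e W sd' k.+1.
Proof.
move=> es pW qW /subsetP AW /subsetP DW eA eD sq sA sD ch.
(* Reversing if necessary, the [a] row is on the side of [p], hence in [D], and the [b] row is in
   [A]. *)
have {sd ch} [a [b [Hs He]]] : chain e (A :|: D) (side p) k.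
  case: (altP (sd =P side p)) ch => [->//|].
  by move=> ne /(chainN es); case: sd (side p) ne => -[].
have aD i : i < k -> a i \in D.
  case/Hs; rewrite inE => /orP[/sA ->|//] _; by case: (side p).
have bA i : i < k -> b i \in A.
  case/Hs; rewrite !inE => _ /orP[//|/sD ->] _; by case: (side p).
exists (side p), (fun i => if i is i'.+1 then a i' else p),
  (fun i => if i is i'.+1 then b i' else q); split=> [[|i]|[|i] [|j]] //=.
- rewrite ltnS => ik; split.
  + exact/DW/aD.
  + exact/AW/bA.
  + exact/sD/aD.
  + exact/sA/bA.
- by rewrite ltnS => jk; rewrite eA ?bA // es eD ?aD.
- by rewrite !ltnS => /He.
Qed.

Definition ipath e u n :=
  {in [pred i | i <= n] &, injective u} /\
  (forall i j, i <= n -> j <= n -> e (u i) (u j) = (j == i.+1) || (i == j.+1)).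

Lemma ipath_side e u n i : bipartite e -> ipath e u n -> i <= n ->
  side (u i) = side (u 0) (+) odd i.
Proof.
move=> eb [_ ue]; elim: i => [|i IHi] i_n; first by rewrite addbF.
have /eb -> : e (u i) (u i.+1) by rewrite ue ?eqxx //; lia.
by rewrite IHi 1?ltnW //= addbN.
Qed.

(* In the decomposition u is the path of chosen vertices down to the vertex
   y = u n, and x is a neighbour of y in the bag of the i-th node. *)
Definition attached e u n i x :=
  [/\ e x (u i), e x (u n) & forall i', i' < i -> ~~ e x (u i')].

(** Through [size_ancestors] this bounds the number of relevant ancestor bags of a vertex; the
    forbidden subgraphs enter the decomposition in this form. *)
Definition short e d := forall u n (s : seq nat), ipath e u n ->
  sorted ltn s -> (forall i : nat, i \in s -> i.+1 < n /\ exists x, attached e u n i x) ->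
  size s <= d.

Definition embeds e (U : Type) (r : rel U) (col : pred U) :=
  exists (g : U -> V) (b : bool), [/\ injective g,
    forall x y, e (g x) (g y) = r x y & forall x, side (g x) = col x (+) b].

End Graphs.

(** [ramsey_avoid] is applied to [t + 1] relations on indices: adjacency of [x i] to [u (j - p)] for
    each [p < t], and closeness of [j] to [i]. Large homogeneous sets are excluded by the bound on
    half graphs and by counting, respectively. *)
Lemma attached_spread (K t m : nat) : exists N, forall (V : finType)
    (side : V -> bool) (e : rel V) (u : nat -> V) n s,
  symmetric e -> bipartite side e -> (forall sd, ~ chain side e setT sd K) ->
  ipath e u n -> sorted ltn s ->
  (forall i : nat, i \in s -> i.+1 < n /\ exists x, attached e u n i x) ->
  N <= size s ->
  exists (s' : seq nat) (x : nat -> V), [/\ size s' = m,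
    forall i : nat, i \in s' -> i.+1 < n /\ attached e u n i (x i),
    pairwise (fun i j => i + t.+1 < j) s'
  & forall p, p < t -> pairwise (fun i j => ~~ e (x i) (u (j - p))) s'].
Proof.
have [N HN] := ramsey_avoid (K + t + 3) m t.+1.
exists N => V side e u n s es eb noch up ss sx Ns.
have [x xP] : exists x : nat -> V, forall i : nat, i \in s -> attached e u n i (x i).
  suff /choice [x xP] : forall i, exists z, i \in s -> attached e u n i z.
    by exists x.
  move=> i; case: (boolP (i \in s)) => [/sx [_ [z zP]]|_]; first by exists z.
  by exists (u 0).
pose r p i j := if p < t then e (x i) (u (j - p)) else j <= i + t.+1.
have /= HNs := HN _ r s _ Ns.
have [|s' [ss' sz' pw]] := HNs; last first.
  have s's := mem_subseq ss'.
  exists s', x; split=> //.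
  + by move=> i /s's si; split; [case: (sx i si) | apply: xP].
  + move: (pw t (ltnSn t)); rewrite /r ltnn.
    by apply: sub_pairwise => i j; rewrite -ltnNge.
  + by move=> p pt; have := pw p (ltnW pt); rewrite /r pt.
move=> p s' pt ss' rs'.
have /(mem_subseq) s's := ss'.
have sos' : sorted ltn s' := subseq_sorted ltn_trans ss' ss.
move: rs'; rewrite /r; case: ltnP => [{}pt|tp] rs'.
  rewrite ltnNge; apply/negP => Ksz.
  pose i l := nth 0 s' l.
  have il l l' : l < l' < size s' -> i l < i l'.
    move=> /andP[ll l's]; apply: (sorted_ltn_nth ltn_trans) => //.
    exact: ltn_trans l's.
  have is' l : l < size s' -> i l \in s by move=> ls; apply/s's/mem_nth.
  have rl l l' : l < l' < size s' -> e (x (i l)) (u (i l' - p)).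
    move=> /andP[ll l's]; move/(pairwiseP 0): rs'; apply=> //; exact: ltn_trans l's.
  have side_x l : l < size s' -> side (x (i l)) = ~~ side (u n).
    by move=> /is' /xP [_ /eb -> _]; rewrite negbK.
  (* Index 0 is kept aside: [x (i 0)] is adjacent to every [u (i l.+1 - p)], which fixes the side of
     the second row. The non-edges hold because [u i] is the first neighbour of [x i] on the
     path. *)
  apply: (noch (~~ side (u n))); exists (fun l => x (i l.+1)), (fun l => u (i l.+1 - p)).
  split.
    move=> l lK; split; rewrite ?inE // ?side_x //; try lia.
    by rewrite -(side_x 0); [apply/eb/rl; lia | lia].
  move=> l l' ll'; split; first by apply: rl; lia.
  have [|_ _] := xP (i l'.+1); first by apply: is'; lia.
  by apply; have := il l.+1 l'.+1; lia.
case: s' sos' rs' {ss' s's} => [|a s'] /=; first by lia.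
move=> pas /andP[/allP al _].
(* All later terms lie in the window of length [t + 1] just after the first term [a]. *)
suff : size s' <= t.+1 by lia.
rewrite -(size_iota a.+1 t.+1); apply: uniq_leq_size.
  by have /= /andP[] := @sorted_uniq _ ltn ltn_trans ltnn (a :: s') pas.
move=> z zs; rewrite mem_iota; have /= := al z zs.
have /allP/(_ z zs) := order_path_min ltn_trans pas.
by lia.
Qed.

(** * The decomposition *)

Section Components.
Variables (V : finType) (e : rel V).
Hypothesis e_sym : symmetric e.
Implicit Types (S K : {set V}).

Definition within S : rel V := fun x y => [&& x \in S, y \in S & e x y].

Definition comp S x : {set V} := [set y | connect (within S) x y].

Definition conn S := forall x y, x \in S -> y \in S -> connect (within S) x y.

Lemma within_sym S : symmetric (within S).
Proof. by move=> x y; rewrite /within e_sym andbCA. Qed.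

Lemma within_csym S : connect_sym (within S).
Proof. exact/sym_connect_sym/within_sym. Qed.

Lemma mem_comp S x : x \in comp S x.
Proof. by rewrite inE connect0. Qed.

Lemma comp_closed S x y z : y \in comp S x -> within S y z -> z \in comp S x.
Proof. by rewrite !inE => xy /connect1; apply: connect_trans. Qed.

Lemma comp_sub S x : x \in S -> comp S x \subset S.
Proof.
move=> xS; apply/subsetP => y; rewrite inE => xy.
have cl : closed (within S) S by move=> a b /and3P[aS bS _]; rewrite aS bS.
by rewrite -(closed_connect cl xy).
Qed.

Lemma comp_eq S x y : y \in comp S x -> comp S y = comp S x.
Proof.
rewrite inE => xy; apply/setP => z; rewrite !inE.
by rewrite (same_connect (@within_csym S) xy).
Qed.

Lemma conn_comp S x : conn (comp S x).
Proof.
have H y : y \in comp S x -> connect (within (comp S x)) x y.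
  rewrite {1}inE => xy; pose Q := [set z in comp S x | connect (within (comp S x)) x z].
  have cl : closed (within S) Q.
    apply: intro_closed; first exact: within_csym.
    move=> a b ab; rewrite !inE => /andP[xa ca].
    have aK : a \in comp S x by rewrite inE.
    have bK := comp_closed aK ab; rewrite inE in bK; rewrite bK /=.
    apply: connect_trans ca (connect1 _).
    by rewrite /within aK inE bK; case/and3P: ab.
  have := closed_connect cl xy; rewrite !inE !connect0 /= => /esym.
  by case/andP.
move=> y z /H xy /H xz; apply: connect_trans xz.
by rewrite within_csym.
Qed.

(** Otherwise the component of [x] in [S :\: K] would be closed in the connected set [S], yet it
    misses [a]. *)
Lemma conn_boundary S K a x : conn S -> K \subset S -> a \in K ->
  x \in S :\: K -> exists2 b, b \in K & exists2 z, z \in comp (S :\: K) x & e b z.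
Proof.
move=> cS /subsetP KS aK xSK.
have [xS xK] : x \in S /\ x \notin K by move: xSK; rewrite inE => /andP[].
apply: contrapT => none.
have cl : closed (within S) (comp (S :\: K) x).
  apply: intro_closed; first exact: within_csym.
  move=> y z /and3P[yS zS yz] yC.
  have yK : y \notin K.
    by have /subsetP/(_ _ yC) := comp_sub xSK; rewrite inE => /andP[].
  case: (boolP (z \in K)) => zK.
    by case: none; exists z => //; exists y => //; rewrite e_sym.
  by apply: comp_closed yC _; rewrite /within !inE yK zK yS zS.
have := closed_connect cl (cS x a xS (KS a aK)).
rewrite /= mem_comp => /esym aC.
by have /subsetP/(_ _ aC) := comp_sub xSK; rewrite inE aK.
Qed.

End Components.

(** * Histories, bags and ancestor lists *)

Section Decomposition.
Variables (V : finType) (side : V -> bool) (e : rel V).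
Hypothesis (e_sym : symmetric e) (e_bip : bipartite side e).
Variables (W : {set V}) (R : pred V) (v0 : V).

(* A node (u, K) stands for the bag of the neighbours of u in the connected
   set K; a history lists the nodes from a root down to some node. *)
Notation node := (V * {set V})%type.
Implicit Types (h : seq node) (p : node) (K A : {set V}).

Definition nbhd u : {set V} := [set x | e u x].

Definition child (K A : {set V}) x : node :=
  let K' := comp e (K :\: A) x in
  (odflt x [pick b in K :&: A | [exists z in K', e b z]], K').

(** [n] is fuel and [h] lists the nodes above [p]. With enough fuel the result is the history ending
    at the node whose bag contains [x]. It names that bag, and ancestry becomes the prefix order. *)
Fixpoint bag n h p x : seq node :=
  if n is n'.+1 then
    if e p.1 x then rcons h p else bag n' (rcons h p) (child p.2 (nbhd p.1) x) x
  else rcons h p.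

Notation p0 := (v0, set0).
Definition pivot h i := (nth p0 h i).1.
Definition domain h i := (nth p0 h i).2.

Definition history h :=
  [/\ 0 < size h -> R (pivot h 0),
    forall i, i < size h ->
      [/\ pivot h i \in W, domain h i \subset W & pivot h i \notin domain h i]
  & forall i, i.+1 < size h -> [/\ pivot h i.+1 \in domain h i,
      e (pivot h i) (pivot h i.+1), domain h i.+1 \subset domain h i
    & forall z, z \in domain h i.+1 -> ~~ e (pivot h i) z]].

(** Invariant of the descent: the bag is non-empty and [p.2] is connected, so by [conn_boundary]
    every component of the rest has a neighbour in the bag and the choice in [child] succeeds. *)
Definition live p := conn e p.2 /\ exists2 z, z \in p.2 & e p.1 z.

Lemma childP K A x a : conn e K -> a \in K -> a \in A -> x \in K -> x \notin A ->
  let p := child K A x in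
  [/\ live p, p.1 \in K :&: A, x \in p.2 & p.2 \subset K :\: A].
Proof.
move=> cK aK aA xK xA; rewrite /= /live /=.
have xKA : x \in K :\: (K :&: A) by rewrite !inE xK (negPf xA).
have eqD : K :\: (K :&: A) = K :\: A by rewrite setDIr setDv set0U.
have aKA : a \in K :&: A by rewrite inE aK aA.
have [b bKA [z zC bz]] := conn_boundary e_sym cK (subsetIl K A) aKA xKA.
rewrite eqD in zC xKA *.
case: pickP => [b' /andP[b'KA /exists_inP[z' z'C b'z']] | none] /=.
  split=> //; first by split; [exact: conn_comp | exists z'].
  + exact: mem_comp.
  + exact: comp_sub.
have := none b; rewrite bKA /= => /exists_inP[]; by exists z.
Qed.

(** The choice depends only on the component; the last two hypotheses rule out the default [x],
    which would vary with the vertex. *)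
Lemma child_eq K A x y : y \in comp e (K :\: A) x ->
  (child K A x).1 \in A -> x \notin A -> child K A y = child K A x.
Proof.
move=> xy; rewrite /child (comp_eq e_sym xy) /=.
by case: pickP => //= _ -> .
Qed.

Lemma history_rcons h p p' : history (rcons h p) -> p'.1 \in p.2 ->
  e p.1 p'.1 -> p'.2 \subset p.2 :\: nbhd p.1 -> p'.1 \notin p'.2 ->
  history (rcons (rcons h p) p').
Proof.
case=> H0 H1 H2 up eup Kp up'; rewrite /history !size_rcons.
have last_p : nth p0 (rcons h p) (size h) = p by rewrite nth_rcons ltnn eqxx.
have [pW pK _] : [/\ p.1 \in W, p.2 \subset W & p.1 \notin p.2].
  by have := H1 (size h); rewrite /pivot /domain size_rcons last_p; apply.
have sub_p : p'.2 \subset p.2 by apply: subset_trans Kp (subsetDl _ _).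
rewrite /pivot /domain in H0 H1 H2 *; rewrite size_rcons in H0 H1 H2.
split=> [_ | i | i].
- by rewrite nth_rcons size_rcons /=; apply: H0.
- rewrite ltnS leq_eqVlt => /orP[/eqP->|ih].
    rewrite nth_rcons size_rcons ltnn eqxx; split=> //.
      exact: (subsetP pK).
    exact: subset_trans sub_p pK.
  by rewrite nth_rcons size_rcons ih; apply: H1.
- rewrite ltnS leq_eqVlt => /orP[/eqP [->]|ih].
    rewrite !(nth_rcons _ (rcons h p)) !size_rcons ltnn eqxx ltnSn last_p.
    split=> // z /(subsetP Kp); rewrite !inE; by case/andP.
  rewrite !(nth_rcons _ (rcons h p)) !size_rcons ih (ltn_trans (ltnSn i) ih).
  exact: H2.
Qed.

Lemma bagP n h p x : history (rcons h p) -> live p -> x \in p.2 -> #|p.2| <= n ->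
  let l := bag n h p x in
  [/\ history l, prefix (rcons h p) l, 0 < size l,
      x \in domain l (size l).-1 & e (pivot l (size l).-1) x].
Proof.
elim: n h p => [|n IHn] h p hp lp xp pn /=.
  by move: pn; rewrite leqn0 cards_eq0 => /eqP p_0; rewrite p_0 inE in xp.
case: ifPn => ex.
  rewrite /domain /pivot size_rcons /= nth_rcons ltnn eqxx.
  by split=> //; exact: prefix_refl.
case: lp => cp [a ap ea].
have aA : a \in nbhd p.1 by rewrite inE.
have xA : x \notin nbhd p.1 by rewrite inE.
have [lp' up xp' sub] := childP cp ap aA xp xA.
case/setIP: up => up; rewrite inE => eup.
have [||H1 H2 H3 H4 H5] := IHn (rcons h p) _ _ lp' xp'.
- apply: history_rcons => //; apply/negP => /(subsetP sub).
  by rewrite !inE eup.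
(* The bag is non-empty, so the domain shrinks strictly and the fuel suffices. *)
- rewrite -ltnS; apply: leq_trans pn; apply: proper_card.
  apply: (sub_proper_trans sub); apply/properP; split; first exact: subsetDl.
  by exists a => //; rewrite !inE ea.
split=> //; apply: prefix_trans H2; exact: prefix_rcons.
Qed.

Lemma bag_prefix n h p x : prefix (rcons h p) (bag n h p x).
Proof.
elim: n h p => [|n IHn] h p /=; first exact: prefix_refl.
case: ifP => _; first exact: prefix_refl.
exact: prefix_trans (prefix_rcons _ _) (IHn _ _).
Qed.

(** Adjacent vertices descend together, since outside the bags they remain in one component; the
    first to enter a bag gives the ancestor. *)
Lemma bag_edge n h p x y : live p -> x \in p.2 -> y \in p.2 -> e x y ->
  prefix (bag n h p x) (bag n h p y) \/ prefix (bag n h p y) (bag n h p x).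
Proof.
elim: n h p => [|n IHn] h p lp xp yp xy /=; first by left; exact: prefix_refl.
case: ifPn => ex.
  left; case: ifP => _; first exact: prefix_refl.
  exact: prefix_trans (prefix_rcons _ _) (bag_prefix _ _ _ _).
case: ifPn => ey.
  right; exact: prefix_trans (prefix_rcons _ _) (bag_prefix _ _ _ _).
case: lp => cp [a ap ea].
have xA : x \notin nbhd p.1 by rewrite inE.
have aA : a \in nbhd p.1 by rewrite inE.
have [lp' up xp' sub] := childP cp ap aA xp xA.
have yC : y \in comp e (p.2 :\: nbhd p.1) x.
  apply: comp_closed (mem_comp _ _ _) _.
  by rewrite /within !inE ex ey xp yp.
rewrite (child_eq yC) //; last by case/setIP: up.
exact: IHn.
Qed.

Lemma domain_mono h i j : history h -> i <= j -> j < size h ->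
  domain h j \subset domain h i.
Proof.
move=> [_ _ H2] /subnK <-; elim: (j - i) => [//|k IHk]; rewrite addSn => lt.
have [_ _ sub _] := H2 _ lt.
by apply: subset_trans sub (IHk _); exact: ltnW.
Qed.

(** Domains are nested, so a later vertex lies in every earlier domain. It differs from the pivot
    there, which is outside its own domain, and from two steps on it lies in a domain which that
    pivot does not see. *)
Lemma history_ipath h y : history h -> 0 < size h ->
    y \in domain h (size h).-1 -> e (pivot h (size h).-1) y ->
  ipath e (fun i => if i < size h then pivot h i else y) (size h).
Proof.
move=> hh h0 yd ey; set w := fun i => _.
have [_ H1 H2] := hh.
have wE i : i < size h -> w i = pivot h i by rewrite /w => ->.
have w_in i j : i < j <= size h -> w j \in domain h i.
  move=> /andP[ij jh]; rewrite /w; case: ltnP => [lt|ge].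
    case: j ij jh lt => // j ij _ lt; have [+ _ _ _] := H2 _ lt.
    by apply/subsetP/domain_mono => //; exact: ltnW.
  by move: yd; apply/subsetP/domain_mono => //; lia.
have w_ne i j : i < j <= size h -> w i != w j.
  move=> ij; apply/eqP => eqw; have := w_in i j ij.
  by rewrite -eqw wE; [have [] := H1 i; [lia | move=> _ _ /negPf->] | lia].
have w_e i j : i < j <= size h -> e (w i) (w j) = (j == i.+1).
  move=> ij; rewrite wE; last lia.
  have [ji|ji] := eqVneq j i.+1.
    rewrite ji /w; case: ltnP => [lt|ge]; first by case: (H2 i lt).
    by have -> : i = (size h).-1 by lia.
  apply: negbTE; have [|_ _ _ H] := H2 i; [lia | apply: H; apply: w_in; lia].
split=> [i j|i j ih jh].
  rewrite !inE => ih jh eqw; have [ij|ij|//] := ltngtP i j.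
    by have := w_ne i j; rewrite eqw eqxx; lia.
  by have := w_ne j i; rewrite eqw eqxx; lia.
have [ij|ij|<-] := ltngtP i j.
- by rewrite w_e; lia.
- by rewrite e_sym w_e; lia.
- by rewrite [RHS](_ : _ = false); [apply/negP => /e_bip; case: side | lia].
Qed.

(* When C misses R, x is isolated (see decompose) and serves as its own root. *)
Definition root (C : {set V}) x := odflt x [pick z in C | R z].
Definition isroot x := x == root (comp e W x) x.
Definition lab x :=
  let C := comp e W x in let r := root C x in
  bag #|V| [::] (r, comp e (C :\ r) x) x.

Lemma nonroot_start x : x \in W -> ~~ isroot x ->
  let C := comp e W x in let r := root C x in
  [/\ history [:: (r, comp e (C :\ r) x)], live (r, comp e (C :\ r) x)
    & x \in C :\ r].
Proof.
move=> xW; rewrite /isroot /root; set C := comp e W x => xr /=.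
have CW : C \subset W := comp_sub e xW.
case: pickP xr => [r /andP[rC Rr] | _] /=; last by rewrite eqxx.
move=> xr; have xCr : x \in C :\ r by rewrite !inE xr connect0.
have KC := comp_sub e xCr.
split=> //.
  split=> // -[|//] _; split=> /=; first exact: (subsetP CW).
    by apply: subset_trans KC _; apply: subset_trans (subsetDl _ _) CW.
  by apply/negP => /(subsetP KC); rewrite !inE eqxx.
split; first exact: conn_comp.
have rC1 : [set r] \subset C by rewrite sub1set.
have [_ /set1P-> [z zK rz]] :=
  conn_boundary e_sym (@conn_comp V e e_sym W x) rC1 (set11 r) xCr.
by exists z.
Qed.

Lemma labP x : x \in W -> ~~ isroot x ->
  let l := lab x in
  [/\ history l, 0 < size l, x \in domain l (size l).-1
    & e (pivot l (size l).-1) x].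
Proof.
move=> xW xr; have [hp lp xC] := nonroot_start xW xr.
by have [] := @bagP #|V| [::] (_, _) x hp lp (mem_comp _ _ _) (max_card _).
Qed.

Lemma comp_edge x y : x \in W -> y \in W -> e x y -> comp e W y = comp e W x.
Proof.
move=> xW yW xy; apply: (comp_eq e_sym).
by apply: comp_closed (mem_comp _ _ _) _; rewrite /within xW yW.
Qed.

Lemma lab_edge x y : x \in W -> y \in W -> ~~ isroot x -> ~~ isroot y ->
  e x y -> prefix (lab x) (lab y) \/ prefix (lab y) (lab x).
Proof.
move=> xW yW xr yr xy; have [hp lp xC] := nonroot_start xW xr.
have [_ _ yC] := nonroot_start yW yr.
have eqr : root (comp e W x) y = root (comp e W x) x.
  move: xr; rewrite /isroot /root; case: pickP => //= _; by rewrite eqxx.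
have eqc := comp_edge xW yW xy; rewrite eqc eqr in yC.
have yK : y \in comp e (comp e W x :\ root (comp e W x) x) x.
  by apply: comp_closed (mem_comp _ _ _) _; rewrite /within xC yC.
rewrite /lab eqc eqr (comp_eq e_sym yK).
exact: bag_edge lp (mem_comp _ _ _) yK xy.
Qed.

(** A history can be arbitrarily long; only the nodes whose bag contains a non-root neighbour of [y]
    are kept. *)
Definition ancestors y : seq (seq node) :=
  [seq take k.+1 (lab y) | k <- iota 0 (size (lab y))
   & [exists x in W, [&& ~~ isroot x, e x y & lab x == take k.+1 (lab y)]]].

Lemma mem_ancestors x y : x \in W -> y \in W -> ~~ isroot x -> ~~ isroot y ->
  e x y -> lab x \notin ancestors y -> lab y \in ancestors x.
Proof.
have main a b : a \in W -> b \in W -> ~~ isroot a -> ~~ isroot b -> e a b ->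
    prefix (lab a) (lab b) -> lab a \in ancestors b.
  move=> aW bW ar br ab; have [_ a0 _ _] := labP aW ar => pre.
  have /eqP tk : take (size (lab a)) (lab b) == lab a by rewrite -prefixE.
  apply/mapP; exists (size (lab a)).-1; last by rewrite prednK.
  rewrite mem_filter mem_iota; apply/andP; split.
    by apply/exists_inP; exists a; rewrite // ar ab prednK ?tk ?eqxx.
  by rewrite add0n prednK //; exact: size_prefix pre.
move=> xW yW xr yr xy; case: (lab_edge xW yW xr yr xy).
  by move=> /(main x y xW yW xr yr xy) ->.
by move=> pre _; apply: main => //; rewrite e_sym.
Qed.

Lemma size_ancestors d y : short e d -> y \in W -> ~~ isroot y ->
  size (ancestors y) <= d.
Proof.
move=> sh yW yr; have [hh h0 yd ey] := labP yW yr; rewrite size_map.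
apply: (sh _ _ _ (history_ipath hh h0 yd ey)).
  by apply: sorted_filter; [exact: ltn_trans | exact: iota_ltn_sorted].
move=> k; rewrite mem_filter mem_iota add0n => /andP[/exists_inP[x xW]].
case/and3P=> xr xy /eqP lx /= kh.
have [_ _ xd ex] := labP xW xr.
have sk : (size (lab x)).-1 = k by rewrite lx size_takel.
have k_lt : k.+1 < size (lab y).
  (* Were [x] in the same bag as [y], both would be neighbours of its pivot, hence on one side,
     against [e x y]. *)
  rewrite ltn_neqAle kh andbT; apply/eqP => sk'.
  move: ex; rewrite lx sk' take_size => /e_bip sx.
  by move: (e_bip xy); rewrite (e_bip ey) sx; case: (side _).
rewrite sk lx /pivot /domain nth_take // in xd ex.
split=> //; exists x; split.
- by rewrite kh e_sym.
- by rewrite ltnn.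
move=> i ik; rewrite (ltn_trans ik kh) e_sym.
have [_ _ H2] := hh.
have [|_ _ _ H] := H2 i; first exact: leq_ltn_trans ik kh.
apply: H; move: xd; apply/subsetP; exact: (domain_mono hh ik).
Qed.

(** The first hypothesis serves a node with a vertex [q] one level higher, the second a root
    node. *)
Lemma node_solvable c l :
    (forall (A D : {set V}) (p q : V), p \in W -> q \in W -> A \subset W ->
       D \subset W -> (forall x, x \in A -> e p x) ->
       (forall y, y \in D -> ~~ e q y) -> side q = ~~ side p ->
       (forall y, y \in D -> side y = side p) ->
       solvable c (fun x y => x \in A /\ y \in D) e) ->
    (forall (A D : {set V}) (p : V), p \in W -> R p -> A \subset W -> D \subset W ->
       (forall x, x \in A -> e p x) -> (forall y, y \in D -> side y = side p) ->
       solvable c (fun x y => x \in A /\ y \in D) e) ->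
  solvable c (fun x y => [/\ [/\ x \in W, ~~ isroot x, y \in W & ~~ isroot y],
    lab x = l & l \in ancestors y]) e.
Proof.
move=> Hinner Hroot.
pose A := [set x in W | ~~ isroot x && (lab x == l)].
pose D := [set y in W | ~~ isroot y && (l \in ancestors y)].
suff : solvable c (fun x y => x \in A /\ y \in D) e.
  apply: solvable_sub => // x y [[xW xr yW yr] lx ly].
  by split=> //; rewrite !inE xW xr yW yr lx eqxx ly.
have [A0|[x0]] := set_0Vmem A.
  by exists (Leaf _ _ true) => // x y []; rewrite A0 inE.
rewrite inE => /and3P[x0W x0r /eqP lx0].
have [hl l0 _ _] := labP x0W x0r; rewrite lx0 in hl l0.
set p := pivot l (size l).-1.
have [R0 H1 H2] := hl.
have [|pW _ _] := H1 (size l).-1; first lia.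
have AW : A \subset W by apply/subsetP => x; rewrite inE => /andP[].
have DW : D \subset W by apply/subsetP => x; rewrite inE => /andP[].
have eA x : x \in A -> e p x.
  rewrite inE => /and3P[xW xr /eqP lx]; by have [_ _ _] := labP xW xr; rewrite lx.
have DP y : y \in D -> y \in domain l (size l).-1 /\ side y = side p.
  rewrite inE => /and3P[yW yr /mapP[k]]; rewrite mem_filter mem_iota add0n.
  case/andP=> /exists_inP[x xW /and3P[xr xy lx]] /= ks lE.
  have [hy y0 yd _] := labP yW yr.
  split; last first.
    have /eA/e_bip : x \in A by rewrite inE xW xr (eqP lx) lE eqxx.
    by rewrite (e_bip xy) => ->; rewrite negbK.
  have -> : domain l (size l).-1 = domain (lab y) k.
    by rewrite /domain lE size_takel //= nth_take.
  have ks1 : k <= (size (lab y)).-1 by rewrite -ltnS prednK.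
  have sy1 : (size (lab y)).-1 < size (lab y) by rewrite prednK.
  exact: (subsetP (domain_mono hy ks1 sy1)).
have sD y : y \in D -> side y = side p by case/DP.
have [l1|l1] := eqVneq (size l) 1.
  apply: (Hroot A D p) => //; rewrite /p l1; exact: R0.
have [|_ pq _ qD] := H2 (size l).-2; first lia.
have l2 : (size l).-2.+1 = (size l).-1 by lia.
rewrite l2 in pq qD.
apply: (Hinner A D p (pivot l (size l).-2)) => //.
- by have [|? _ _] := H1 (size l).-2; first lia.
- by move=> y /DP [/qD].
- by rewrite (e_bip pq) negbK.
Qed.

(** Pairs with a root are settled first. Otherwise [y] tries its ancestor list against the bag of
    [x], then [x] tries its own list against the bag of [y]; if both fail there is no edge. The two
    lists cost [d + d]. *)
Lemma decompose c d : short e d ->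
    (forall x y, x \in W -> y \in W -> e x y -> R x || R y) ->
    (forall (A D : {set V}) (p q : V), p \in W -> q \in W -> A \subset W ->
       D \subset W -> (forall x, x \in A -> e p x) ->
       (forall y, y \in D -> ~~ e q y) -> side q = ~~ side p ->
       (forall y, y \in D -> side y = side p) ->
       solvable c (fun x y => x \in A /\ y \in D) e) ->
    (forall (A D : {set V}) (p : V), p \in W -> R p -> A \subset W -> D \subset W ->
       (forall x, x \in A -> e p x) -> (forall y, y \in D -> side y = side p) ->
       solvable c (fun x y => x \in A /\ y \in D) e) ->
  solvable (d + d + c + 6) (fun x y => x \in W /\ y \in W) e.
Proof.
move=> sh HR Hinner Hroot.
have Hnode l := node_solvable l Hinner Hroot.
(* If [x] is the root of its component, any [y] in that component knows this root and hence the
   answer; a component missing [R] has no edges by [HR]. *)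
have from_root : solvable 3 (fun x y => [/\ x \in W, y \in W & isroot x]) e.
  apply: (@solvable_list _ _ _ (comp e W) (fun y => [:: comp e W y]) 1 1 0).
  - by [].
  - move=> C; pose g y := if [pick z in C | R z] is Some z then e z y else false.
    suff /solvable_swap : solvable 1 (fun y x => [/\ [/\ x \in W, y \in W & isroot x],
      comp e W x = C & C \in [:: comp e W y]]) (fun y x => e x y) by [].
    apply: (@solvable_left _ _ g) => y x [[xW yW xr] xC]; rewrite inE => /eqP yC.
    move: xr; rewrite /isroot /root xC /g; case: pickP => [z _ /eqP/= <-//|none _].
    apply/negP => exy; have /orP[Rx|Ry] := HR x y xW yW exy.
      by have := none x; rewrite Rx -xC mem_comp.
    by have := none y; rewrite Ry yC mem_comp.
  - apply: (solvable_const (v := false)) => x y [[xW yW _]]; rewrite inE => ne.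
    by apply: contraNF ne => /(comp_edge xW yW) ->.
have inside : solvable (d + d + c + 1)
    (fun x y => [/\ x \in W, ~~ isroot x, y \in W & ~~ isroot y]) e.
  have Hback : solvable (d + c.+1) (fun x y =>
      [/\ x \in W, ~~ isroot x, y \in W & ~~ isroot y] /\ lab x \notin ancestors y) e.
    rewrite -(max0n c.+1).
    suff /solvable_swap : solvable (d + maxn 0 c.+1) (fun y x =>
      [/\ x \in W, ~~ isroot x, y \in W & ~~ isroot y] /\ lab x \notin ancestors y)
      (fun y x => e x y) by [].
    apply: (@solvable_list _ _ _ lab ancestors).
    - by move=> y x [[xW xr _ _] _]; apply: size_ancestors.
    - move=> l; apply: solvable_sub (Hnode l) => // y x [[[xW xr yW yr] _] ly lx].
      by rewrite e_sym.
    - apply: (solvable_const (v := false)) => y x [[[xW xr yW yr] nx] ny].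
      by apply: contraNF ny => xy; apply: mem_ancestors nx.
  apply: (solvable_sub (c := d + maxn (d + c.+1) c.+1)); first by lia.
    by move=> x y H; split; first exact: H.
  apply: (@solvable_list _ _ _ lab ancestors) => //.
  by move=> x y [_ _ yW yr]; apply: size_ancestors.
apply: (solvable_sub (c := (d + d + c + 4).+2)); first by lia.
  by move=> x y H; split; first exact: H.
apply: (solvable_node (alpha := isroot) (beta := fun _ => 1)); last first.
  apply: solvable_sub from_root; first by lia.
  by move=> x y [[xW yW] xr]; split=> //; split=> //; move: xr; case: isroot.
apply: (solvable_node (alpha := fun _ => 1) (beta := isroot)); last first.
  apply: solvable_sub (solvable_swap from_root); first by lia.
  move=> x y [[[xW yW] _] yr]; split; last by rewrite e_sym.
  by split=> //; move: yr; case: isroot.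
apply: solvable_sub inside; first by lia.
move=> x y [[[xW yW] xr] yr]; split=> //; split=> //.
  by move: xr; case: isroot.
by move: yr; case: isroot.
Qed.

End Decomposition.

(** * Induction on the length of half graphs *)

Section InductionStep.
Variables (V : finType) (side : V -> bool) (e : rel V).
Hypothesis (e_sym : symmetric e) (e_bip : bipartite side e).
Variables (W : {set V}) (n c : nat).
Hypothesis no_chain : forall sd, ~ chain side e W sd n.+1.
Hypothesis IH : forall W' : {set V}, (forall sd, ~ chain side e W' sd n) ->
  solvable c (fun x y => x \in W' /\ y \in W') e.

Lemma solvable_inner (A D : {set V}) (p q : V) :
    p \in W -> q \in W -> A \subset W -> D \subset W ->
    (forall x, x \in A -> e p x) -> (forall y, y \in D -> ~~ e q y) ->
    side q = ~~ side p -> (forall y, y \in D -> side y = side p) ->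
  solvable c (fun x y => x \in A /\ y \in D) e.
Proof.
move=> pW qW AW DW eA eD sq sD.
apply: solvable_sub (IH (W' := A :|: D) _) => // [x y [xA yD]|sd ch].
  by rewrite !inE xA yD orbT.
have [sd' ch'] := chain_extend e_sym pW qW AW DW eA eD sq
  (fun x xA => e_bip (eA x xA)) sD ch.
exact: no_chain ch'.
Qed.

(** The half graph is extended in the complement and carried back to [e]; the protocol that [IH]
    gives for [e] is negated. *)
Lemma solvable_inner_compl (A D : {set V}) (p q : V) :
    p \in W -> q \in W -> A \subset W -> D \subset W ->
    (forall x, x \in A -> compl_rel side e p x) ->
    (forall y, y \in D -> ~~ compl_rel side e q y) ->
    side q = ~~ side p -> (forall y, y \in D -> side y = side p) ->
  solvable c (fun x y => x \in A /\ y \in D) (compl_rel side e).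
Proof.
move=> pW qW AW DW eA eD sq sD.
have sA x (xA : x \in A) := compl_rel_bip (eA x xA).
have /solvable_negb H : solvable c (fun x y => x \in A :|: D /\ y \in A :|: D) e.
  apply: IH => sd /(chain_to_compl e_sym) ch.
  have [sd' ch'] := chain_extend (compl_rel_sym side e_sym) pW qW AW DW eA eD sq sA sD ch.
  exact: no_chain (chain_of_compl e_sym ch').
apply: solvable_sub H => // x y [xA yD]; rewrite !inE xA yD orbT.
by rewrite /compl_rel (sA x xA) (sD y yD); case: (side p).
Qed.

End InductionStep.

(** Each level nests two decompositions, one in the graph and one in its bipartite complement. *)
Fixpoint cost (d n : nat) : nat :=
  if n is n'.+1 then d + d + (d + d + cost d n' + 6) + 6 else 0.

Lemma solvable_cost d n (V : finType) (side : V -> bool) (e : rel V) (W : {set V}) :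
    symmetric e -> bipartite side e -> short e d -> short (compl_rel side e) d ->
    (forall sd, ~ chain side e W sd n) ->
  solvable (cost d n) (fun x y => x \in W /\ y \in W) e.
Proof.
move=> es eb sh shc; elim: n W => [|n IHn] W noch /=.
  have [->|[v _]] := set_0Vmem W.
    by exists (Leaf _ _ true) => // x y []; rewrite inE.
  by case: (noch true); exists (fun _ => v), (fun _ => v); split=> // i j;
    rewrite ltn0 andbF.
have [->|[v0 _]] := set_0Vmem W.
  by exists (Leaf _ _ true) => // x y []; rewrite inE.
have ces := compl_rel_sym side es.
have ceb : bipartite side (compl_rel side e) := @compl_rel_bip V side e.
apply: (decompose es eb (R := predT) v0 sh) => //.
  move=> A D p q pW qW AW DW eA eD sq sD.
  have := solvable_inner es eb noch IHn pW qW AW DW eA eD sq sD.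
  by apply: solvable_sub => //; lia.
(* Root node: [A :|: D] is decomposed in the bipartite complement, with roots in [A]. *)
move=> A D p pW _ AW DW eA sD.
have sA x : x \in A -> side x = ~~ side p by move=> /eA /eb.
have ADW : A :|: D \subset W by rewrite subUset AW.
have inA x : x \in A :|: D -> side x = ~~ side p -> x \in A.
  rewrite inE => /orP[//|/sD ->]; by case: (side p).
suff : solvable (d + d + cost d n + 6)
    (fun x y => x \in A :|: D /\ y \in A :|: D) (compl_rel side e).
  move=> /solvable_negb; apply: solvable_sub => // x y [xA yD].
  rewrite !inE xA yD orbT; split=> //.
  by rewrite /compl_rel (sA x xA) (sD y yD); case: (side p) => /=; rewrite negbK.
apply: (decompose ces ceb (R := mem A) v0 shc).
(* [D] lies on one side, so every edge of the complement inside [A :|: D] has an end in [A]. *)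
- move=> x y xW yW xy /=; case: (boolP (x \in A)) => //= xA; apply: inA => //.
  rewrite (ceb _ _ xy); congr (~~ _); apply: sD.
  by move: xW; rewrite inE (negPf xA).
- move=> A' D' p' q' /(subsetP ADW) pW' /(subsetP ADW) qW' AW' DW'.
  by apply: solvable_inner_compl; rewrite // ?(subset_trans _ ADW).
(* [D'] is on the side of [p'], hence inside [A]. So [p] is complete to it in [e], that is,
   anticomplete in the complement, and serves as [q]. *)
move=> A' D' p' _ p'A AW' DW' eA' sD'.
have sp' := sA p' p'A.
apply: (solvable_inner_compl es noch IHn (p := p') (q := p)) => //.
- exact: (subsetP AW).
- exact: subset_trans ADW.
- exact: subset_trans ADW.
- move=> y yD'; rewrite /compl_rel negb_and negbK; apply/orP; right; rewrite negbK.
  apply/eA/inA; first exact: (subsetP DW').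
  by rewrite sD'.
- by rewrite sp' negbK.
Qed.

(** * Forbidden stars and cycles *)

(** The star has centre [u n]; its [l]-th path is [x (a l)], [u (a l)], [u (a l - 1)] and so on. *)
Lemma short_of_star K s t : exists d, forall (V : finType) (side : V -> bool) e,
  symmetric e -> bipartite side e -> (forall sd, ~ chain side e setT sd K) ->
  ~ embeds side e (@star_edge s t) (@star_col s t) -> short e d.
Proof.
have [N HN] := attached_spread K t s.+1.
exists N => V side e es eb noch noemb u n sq up sos Hs.
rewrite leqNgt; apply/negP => /ltnW Nsq; apply: noemb.
have [s' [x [sz Hx sp nx]]] := HN V side e u n sq es eb noch up sos Hs Nsq.
(* The first of the [s + 1] indices is dropped, so that [a l > t + 1] and the subtractions [a l - p]
   do not truncate. *)
pose a (l : 'I_s) := nth 0 s' l.+1.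
have ls (l : 'I_s) : l.+1 < size s' by rewrite sz ltnS.
have as' l : a l \in s' by apply: mem_nth.
have a_lt (l l' : 'I_s) : l < l' -> a l + t.+1 < a l'.
  by move=> ll'; apply: (pairwiseP 0 sp); rewrite ?inE.
have a_ge l : t.+1 < a l.
  have : nth 0 s' 0 + t.+1 < a l by apply: (pairwiseP 0 sp); rewrite ?inE // sz.
  by lia.
have a_n l : (a l).+1 < n by case: (Hx _ (as' l)).
have xu l : e (x (a l)) (u (a l)) by case: (Hx _ (as' l)) => _ [].
have xn l : e (x (a l)) (u n) by case: (Hx _ (as' l)) => _ [].
have [u_inj ue] := up.
have eirr z : e z z = false by apply/negP => /eb; case: (side z).
have E_xu l l' p : p < t -> e (x (a l)) (u (a l' - p)) = (l == l') && (p == 0).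
  move=> pt; have [ll'|ll'|ll'] := ltngtP l l'.
  - have -> : (l == l') = false by apply/eqP => E; rewrite E ltnn in ll'.
    by apply: negbTE; apply: (pairwiseP 0 (nx p pt)); rewrite ?inE.
  - have -> : (l == l') = false by apply/eqP => E; rewrite E ltnn in ll'.
    apply: negbTE; have [_ [_ _ H]] := Hx _ (as' l); apply: H.
    by have := a_lt _ _ ll'; lia.
  rewrite -(val_inj ll') eqxx; case: p pt => [|p] pt; first by rewrite subn0 xu.
  apply: negbTE; have [_ [_ _ H]] := Hx _ (as' l); apply: H.
  by have := a_ge l; lia.
have E_uu l l' p p' : p < t -> p' < t ->
    e (u (a l - p)) (u (a l' - p')) = (l == l') && ((p' == p.+1) || (p == p'.+1)).
  move=> pt p't; rewrite ue; [|have := a_n l; lia|have := a_n l'; lia].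
  have := a_ge l; have := a_ge l'; have [ll'|ll'|ll'] := ltngtP l l'.
  - have -> : (l == l') = false by apply/eqP => E; rewrite E ltnn in ll'.
    by have := a_lt _ _ ll'; lia.
  - have -> : (l == l') = false by apply/eqP => E; rewrite E ltnn in ll'.
    by have := a_lt _ _ ll'; lia.
  by rewrite (val_inj ll') eqxx; lia.
have E_nu l p : e (u n) (u (a l - p)) = false.
  by rewrite ue; have := a_n l; lia.
have sx l : side (x (a l)) = ~~ side (u n) by rewrite (eb _ _ (xn l)) negbK.
have su l p : p < t -> side (u (a l - p)) = side (u n) (+) odd p.
  move=> pt; have := eb _ _ (xu l); rewrite sx negbK => <-.
  have al := a_ge l; have an := a_n l.
  rewrite (ipath_side eb up (i := a l - p)); last lia.
  rewrite (ipath_side eb up (i := a l)); last lia.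
  rewrite oddB; last lia.
  by rewrite addbA.
pose g (v : option ('I_s * 'I_t)) := if v is Some (l, j) then
    if val j is p.+1 then u (a l - p) else x (a l) else u n.
have E_g v w : e (g v) (g w) = star_edge v w.
  case: v w => [[l [[|p] pt]]|] [[l' [[|p'] p't]]|] //=.
  - by rewrite andbF; apply/negP => /eb; rewrite !sx; case: (side _).
  - by rewrite E_xu 1?ltnW //= orbF !eqSS.
  - by rewrite xn.
  - by rewrite es E_xu 1?ltnW //= eq_sym !eqSS.
  - by rewrite E_uu 1?ltnW //= !eqSS.
  - by rewrite es E_nu.
  - by rewrite es xn.
have g_inj : injective g.
  move=> v w gvw.
  have E z : star_edge v z = star_edge w z by rewrite -!E_g gvw.
  case: v w gvw E => [[l [[|p] pt]]|] [[l' [[|p'] p't]]|] //= gvw E.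
  - have xl : x (a l) = x (a l') by [].
    have : e (x (a l)) (u (a l' - 0)) by rewrite xl subn0.
    rewrite E_xu // => /andP[/eqP-> _]; congr (Some (_, _)); exact: val_inj.
  - by have := xn l; rewrite gvw es E_nu.
  - by have := xn l; rewrite gvw eirr.
  - by have := xn l'; rewrite -gvw es E_nu.
  - have : e (x (a l)) (u (a l - 0)) by rewrite subn0.
    have eqi : a l - p = a l' - p'.
      by apply: u_inj gvw; rewrite inE; [have := a_n l | have := a_n l']; lia.
    have [ll'|ll'|ll'] := ltngtP l l'.
    + by have := a_lt _ _ ll'; have := a_ge l; have := a_ge l'; lia.
    + by have := a_lt _ _ ll'; have := a_ge l; have := a_ge l'; lia.
    have ell := val_inj ll'; subst l'; move=> _; congr (Some (_, _)).
    by apply: val_inj => /=; have := a_ge l; lia.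
  - by have := u_inj _ _ _ _ gvw; rewrite !inE; have := a_n l; lia.
  - by have := xn l'; rewrite -gvw eirr.
  - by have := u_inj _ _ _ _ gvw; rewrite !inE; have := a_n l'; lia.
exists g, (side (u n)); split=> // -[[l [[|p] pt]]|] //=.
by rewrite su 1?ltnW // negbK addbC.
Qed.

(** The cycle is [x] with the segment of the path from its last neighbour before [j] to its first
    neighbour from [j] on. *)
Lemma short_of_cycles K T : exists d, forall (V : finType) (side : V -> bool) e,
  symmetric e -> bipartite side e -> (forall sd, ~ chain side e setT sd K) ->
  (forall t', 4 <= t' -> ~~ odd t' -> T <= t' ->
     ~ embeds side e (@cycle_edge t') (@cycle_col t')) -> short e d.
Proof.
have [N HN] := attached_spread K (T + 4) 2.
exists N => V side e es eb noch noemb u n sq up sos Hs.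
rewrite leqNgt; apply/negP => /ltnW Nsq.
have [s' [x' [sz Hx sp nx]]] := HN V side e u n sq es eb noch up sos Hs Nsq.
case: s' sz Hx sp nx => [|i [|j [|? ?]]] //= _ Hx.
rewrite !andbT => ij nx.
have [i_n [xi xn ni]] := Hx i (mem_head _ _).
have [j_n _] := Hx j (mem_last i [:: j]).
set x := x' i in xi xn ni nx.
have nxj p : p < T + 4 -> ~~ e x (u (j - p)) by move=> /nx; rewrite !andbT.
have [u_inj ue] := up.
have eirr z : e z z = false by apply/negP => /eb; case: (side z).
have ex1 : exists q, (q < j) && e x (u q) by exists i; rewrite xi andbT; lia.
have ub1 q : (q < j) && e x (u q) -> q <= j by case/andP=> /ltnW.
case: (ex_maxnP ex1 ub1) => q1 /andP[q1j xq1] q1max.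
have ex2 : exists q, [&& j <= q, q <= n & e x (u q)].
  by exists n; rewrite xn leqnn /= andbT; lia.
case: (ex_minnP ex2) => q2 /and3P[jq2 q2n xq2] q2min.
have gap q : q1 < q < q2 -> e x (u q) = false.
  move=> q12; apply/negP => xq; have [qj|jq] := ltnP q j.
    by have := q1max q; rewrite xq qj => /(_ isT); lia.
  by have := q2min q; rewrite xq jq andbT => /(_ _); lia.
(* [x] misses the [T + 4] vertices [u (j - p)], which makes the cycle long. *)
have q1_far : q1 + (T + 4) <= j.
  rewrite leqNgt; apply/negP => lt; have := nxj (j - q1).
  by rewrite subKn ?(ltnW q1j) // xq1; lia.
pose m := q2 - q1.
have [m4 mT] : 4 <= m /\ T <= m by rewrite /m; lia.
have sq12 : odd m = false.
  have : side (u q1) = side (u q2) by rewrite (eb _ _ xq1) (eb _ _ xq2).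
  rewrite (ipath_side eb up (i := q1)); last lia.
  rewrite (ipath_side eb up (i := q2)) // oddB; last lia.
  by move/addbI=> ->; rewrite addbb.
apply: (noemb m.+2); rewrite ?sq12 /= ?negbK ?sq12 //; try lia.
(* The segment takes the numbers 0 to [m], and [x] the last number [m + 1]. *)
pose g (k : 'I_m.+2) := if k == m.+1 :> nat then x else u (q1 + k).
have xu k : k <= m -> e x (u (q1 + k)) = (k == 0) || (k == m).
  case: k => [|k] km; first by rewrite addn0 xq1.
  have [->|km'] := eqVneq k.+1 m; first by rewrite orbT /m subnKC ?xq2 //; lia.
  by apply: gap; rewrite /m in km km' *; lia.
have modE (k : 'I_m.+2) : k.+1 %% m.+2 = if k == m.+1 :> nat then 0 else k.+1.
  case: eqP => [->|]; first by rewrite modnn.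
  by have := ltn_ord k => ? ?; rewrite modn_small //; lia.
have uq k k' : k <= m -> k' <= m ->
    e (u (q1 + k)) (u (q1 + k')) = (k' == k.+1) || (k == k'.+1).
  by rewrite /m => km km'; rewrite ue; lia.
have E_g k k' : e (g k) (g k') = cycle_edge k k'.
  rewrite /cycle_edge !modE /g; have kl := ltn_ord k; have k'l := ltn_ord k'.
  case: eqP => [->|kn]; case: eqP => [->|k'n]; rewrite ?eirr //.
  - by rewrite xu; lia.
  - by rewrite es xu; lia.
  - by rewrite uq; lia.
have xNu k : k <= m -> x <> u (q1 + k).
  move=> km E; have := xu 0 isT; have := xu m (leqnn m).
  by rewrite E !uq //; lia.
exists g, (side (u q1)); split=> // [k k'|k].
  rewrite /g; have kl := ltn_ord k; have k'l := ltn_ord k'.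
  case: eqP => [kE|kn]; case: eqP => [k'E|k'n] E; apply: val_inj => /=.
  - by rewrite kE k'E.
  - by case: (@xNu k'); [lia|].
  - by case: (@xNu k); [lia|].
  - by have := u_inj _ _ _ _ E; rewrite !inE /m in kl k'l kn k'n *; lia.
rewrite /g /cycle_col; have kl := ltn_ord k; case: eqP => [->|kn].
  by rewrite /= sq12 (eb _ _ xq1) /=; case: (side x).
rewrite (ipath_side eb up); last by rewrite /m in kl kn *; lia.
rewrite (ipath_side eb up (i := q1)); last lia.
by rewrite oddD addbA addbC.
Qed.

(** * From bipartite graphs to graphs with a side function *)

Definition part (G : bigraph) (v : vertex G) : bool :=
  if v is inr _ then true else false.

Lemma adj_sym (G : bigraph) : symmetric (@adj G).
Proof. by move=> [x|y] [x'|y']. Qed.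

Lemma adj_bip (G : bigraph) : bipartite (@part G) (@adj G).
Proof. by move=> [x|y] [x'|y']. Qed.

(** Rows of a [chain] may repeat vertices. Keeping the even indices makes them distinct: the index
    [2 i + 1] of the other row tells [2 i] from every later even index. *)
Lemma has_chain_of_chain (G : bigraph) sd k :
  chain (@part G) (@adj G) setT sd k.*2 -> has_chain G k.
Proof.
move=> [a [b [Hs He]]].
have dlt (i : 'I_k) : i.*2 < k.*2 by rewrite ltn_double.
have Hlt (i j : 'I_k) : i < j -> i.*2 < i.*2.+1 < k.*2 /\ i.*2.+1 < j.*2 < k.*2.
  by have := ltn_ord j; lia.
have a_ne (i j : 'I_k) : i < j -> a i.*2 <> a j.*2.
  move=> /Hlt [l1 l2] E; have [+ _] := He _ _ l1; have [_] := He _ _ l2.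
  by rewrite E => /negPf->.
have b_ne (i j : 'I_k) : i < j -> b i.*2 <> b j.*2.
  move=> /Hlt [l1 l2] E; have [_] := He _ _ l1; have [+ _] := He _ _ l2.
  by rewrite E => ->.
apply/existsP; exists [ffun i : 'I_k => a i.*2].
apply/existsP; exists [ffun i : 'I_k => b i.*2]; apply/and4P; split.
- apply/injectiveP => i j; rewrite !ffunE => E; apply: val_inj.
  by case: (ltngtP i j) => // /a_ne; rewrite E.
- apply/injectiveP => i j; rewrite !ffunE => E; apply: val_inj.
  by case: (ltngtP i j) => // /b_ne; rewrite E.
- apply/forallP => i; apply/forallP => j; rewrite !ffunE; apply/eqP => E.
  have [_ _ sa _] := Hs _ (dlt i); have [_ _ _ sb] := Hs _ (dlt j).
  by move: sb; rewrite -E sa; case: (sd).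
apply/forallP => i; apply/forallP => j; apply/implyP => ij; rewrite !ffunE.
have [|ab ba] := He i.*2 j.*2; first by have := ltn_ord j; lia.
by rewrite ab adj_sym ba.
Qed.

Lemma embeds_contains (G : bigraph) (U : finType) (r : rel U) (col : pred U) :
  embeds (@part G) (@adj G) r col -> contains_induced G (bigraph_of r col).
Proof.
move=> [g [b [g_inj gE gs]]].
pose f (v : vertex (bigraph_of r col)) :=
  match v with inl x => g (val x) | inr y => g (val y) end.
exists f; split=> [[x|x] [y|y] /g_inj E|[x|x] [y|y]] /=.
- by congr inl; apply: val_inj.
- by have := valP x; have := valP y; rewrite /= E => ->.
- by have := valP x; have := valP y; rewrite /= E => /negPf->.
- by congr inr; apply: val_inj.
- apply/negP => /adj_bip; rewrite !gs (negPf (valP x)) (negPf (valP y)).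
  by case: b {gs}.
- by rewrite gE.
- by rewrite adj_sym gE.
- by apply/negP => /adj_bip; rewrite !gs (valP x) (valP y); case: b {gs}.
Qed.

Lemma embeds_compl_contains (G : bigraph) (U : finType) (r : rel U) (col : pred U) :
  embeds (@part G) (compl_rel (@part G) (@adj G)) r col ->
  contains_induced G (bicompl (bigraph_of r col)).
Proof.
move=> [g [b [g_inj gE gs]]].
pose f (v : vertex (bicompl (bigraph_of r col))) :=
  match v with inl x => g (val x) | inr y => g (val y) end.
have adjE x y : part (g x) != part (g y) -> adj (g x) (g y) = ~~ r x y.
  by rewrite -gE /compl_rel => -> /=; rewrite negbK.
exists f; split=> [[x|x] [y|y] /g_inj E|[x|x] [y|y]] /=.
- by congr inl; apply: val_inj.
- by have := valP x; have := valP y; rewrite /= E => ->.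
- by have := valP x; have := valP y; rewrite /= E => /negPf->.
- by congr inr; apply: val_inj.
- apply/negP => /adj_bip; rewrite !gs (negPf (valP x)) (negPf (valP y)).
  by case: b {gs}.
- by rewrite adjE // !gs (negPf (valP x)) (valP y); case: b {gs}.
- by rewrite adj_sym adjE // !gs (negPf (valP y)) (valP x); case: b {gs}.
- by apply/negP => /adj_bip; rewrite !gs (valP x) (valP y); case: b {gs}.
Qed.

Theorem theorem1p4 (C : bigraph -> Prop)
  (C_iso : iso_closed C) (C_stable : stable C)
  (C_free :
    (exists s t : nat, 0 < s /\ 0 < t /\
       free_of C (subdivided_star s t) /\
       free_of C (bicompl (subdivided_star s t)))
    \/
    (exists t : nat, forall t' : nat, 4 <= t' -> ~~ odd t' -> t <= t' ->
       free_of C (even_cycle t') /\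
       free_of C (bicompl (even_cycle t')))) :
  DEq_bounded C.
Proof.
(* [k.+1] exceeds every chain-index in the class, and the doubling is the price of
   [has_chain_of_chain]. *)
have [k Ck] := C_stable; pose K := k.+1.*2.
have noch G sd : C G -> ~ chain (@part G) (@adj G) setT sd K.
  move=> CG /has_chain_of_chain; have [_ maxG] := chain_indexP G.
  by move=> /maxG lt; have := leq_trans lt (Ck G CG); rewrite ltnn.
have noch' G sd : C G -> ~ chain (@part G) (compl_rel (@part G) (@adj G)) setT sd K.
  by move=> CG /(chain_of_compl (@adj_sym G)); apply: noch.
have [d Hd] : exists d, forall G, C G ->
    short (@adj G) d /\ short (compl_rel (@part G) (@adj G)) d.
  case: C_free => [[s [t [_ [_ [free1 free2]]]]]|[t free]].
    have [d Hd] := short_of_star K s t.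
    exists d => G CG; split; apply: (Hd _ (@part G)).
    - exact: adj_sym.
    - exact: adj_bip.
    - by move=> sd; apply: noch.
    - by move=> /embeds_contains; apply: free1.
    - exact/compl_rel_sym/adj_sym.
    - exact: compl_rel_bip.
    - by move=> sd; apply: noch'.
    - by move=> /embeds_compl_contains; apply: free2.
  have [d Hd] := short_of_cycles K t.
  exists d => G CG; split; apply: (Hd _ (@part G)).
  - exact: adj_sym.
  - exact: adj_bip.
  - by move=> sd; apply: noch.
  - by move=> t' t4 to tt /embeds_contains; apply: (proj1 (free t' t4 to tt)).
  - exact/compl_rel_sym/adj_sym.
  - exact: compl_rel_bip.
  - by move=> sd; apply: noch'.
  - by move=> t' t4 to tt /embeds_compl_contains; apply: (proj2 (free t' t4 to tt)).
exists (cost d K) => G CG; have [sh shc] := Hd G CG.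
have := solvable_cost (@adj_sym G) (@adj_bip G) sh shc (fun sd => @noch G sd CG).
(* The protocol takes any two vertices; its inputs are now restricted to the two parts. *)
case/(solvable_comp (inl : bX G -> vertex G) (inr : bY G -> vertex G)) => T Tc TP.
rewrite /DEq; case: ex_minnP => m _ /(_ (depth T)) H; apply: leq_trans Tc.
apply: H; apply/asboolP; exists T; split=> // x y.
by rewrite TP // !inE.
Qed.
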